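(* Assume exactness, i.e. $\operatorname{argmin}_{x\in\mathbb{R}^n} f(x)=\mathcal{L}$. Let $\{x_k\}_{k\ge0}$ be the iterates produced by iBasic with structured inexactness error (the algorithm described in the context) with unit stepsize $\omega=1$, where at each iteration $k$ the inexact solution of $\mathbf{M}_k\lambda=d_k$ is $\lambda_k^{\approx}=\lambda_k^r$, the output of $r$ steps of an iterative method started at $\lambda_k^0=0$, satisfying $$\mathbb{E}\big[\|\lambda_k^r-\lambda_k^*\|_{\mathbf{M}_k}^2\mid x_k,\mathbf{S}_k\big]\le\rho_{\mathbf{S}_k}^r\|\lambda_k^0-\lambda_k^*\|_{\mathbf{M}_k}^2\quad\text{for all }k,$$ with $\rho_{\mathbf{S}_k}\in(0,1)$ for every choice of $\mathbf{S}_k\sim\mathcal{D}$. Let $x_*=\Pi_{\mathcal{L},\mathbf{B}}(x_0)$. Suppose further that there exists a scalar $\theta<1$ such that, with probability 1, $\rho_{\mathbf{S}_k}\le\theta$. Then for all $k\ge0$ $$\mathbb{E}\big[\|x_k-x_*\|_{\mathbf{B}}^2\big]\le\big[1-(1-\theta^r)\lambda_{\min}^+\big]^k\|x_0-x_*\|_{\mathbf{B}}^2.$$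
   Context: Let $\mathbf{A}\in\mathbb{R}^{m\times n}$, $b\in\mathbb{R}^m$ be such that the linear system $\mathbf{A}x=b$ is consistent, and let $\mathcal{L}=\{x:\mathbf{A}x=b\}$. Let $\mathbf{B}\in\mathbb{R}^{n\times n}$ be symmetric positive definite, $\|x\|_{\mathbf{B}}=\sqrt{x^\top\mathbf{B}x}$. $\Pi_{\mathcal{L},\mathbf{B}}(x)=\operatorname{argmin}_{x'\in\mathcal{L}}\|x'-x\|_{\mathbf{B}}$. $^\dagger$ is the Moore-Penrose pseudoinverse. For a symmetric positive semidefinite matrix $\mathbf{M}$, $\|\lambda\|_{\mathbf{M}}=\sqrt{\lambda^\top\mathbf{M}\lambda}$ (a seminorm). Let $\mathcal{D}$ be a distribution over real matrices $\mathbf{S}$ with $m$ rows ($q$ denotes the number of columns). For $\mathbf{S}\sim\mathcal{D}$ put $\mathbf{H}=\mathbf{S}(\mathbf{S}^\top\mathbf{A}\mathbf{B}^{-1}\mathbf{A}^\top\mathbf{S})^\dagger\mathbf{S}^\top$, $\mathbf{Z}=\mathbf{A}^\top\mathbf{H}\mathbf{A}$, $f_{\mathbf{S}}(x)=\frac12(\mathbf{A}x-b)^\top\mathbf{H}(\mathbf{A}x-b)$, and $f(x)=\mathbb{E}_{\mathbf{S}\sim\mathcal{D}}[f_{\mathbf{S}}(x)]$ (all expectations assumed to exist). Let $\mathbf{W}=\mathbf{B}^{-1/2}\mathbb{E}[\mathbf{Z}]\mathbf{B}^{-1/2}$ and let $\lambda_{\min}^+$ be its smallest nonzero eigenvalue.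 iBasic with structured inexactness error: given a fixed $x_0\in\mathbb{R}^n$ and $\omega>0$, for $k=0,1,2,\dots$: draw a fresh sample $\mathbf{S}_k\sim\mathcal{D}$ (independent of the past, in particular of $x_k$); put $\mathbf{M}_k=\mathbf{S}_k^\top\mathbf{A}\mathbf{B}^{-1}\mathbf{A}^\top\mathbf{S}_k$ and $d_k=\mathbf{S}_k^\top(b-\mathbf{A}x_k)$; using an iterative (possibly randomized) method compute an approximation $\lambda_k^{\approx}\in\mathbb{R}^q$ of the least norm solution $\lambda_k^*=\mathbf{M}_k^\dagger d_k$ of the linear system $\mathbf{M}_k\lambda=d_k$; set $x_{k+1}=x_k+\omega\mathbf{B}^{-1}\mathbf{A}^\top\mathbf{S}_k\lambda_k^{\approx}$. *)

(* Defs.v *)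
From HB Require Import structures.
From mathcomp Require Import all_boot all_order all_algebra.
From mathcomp Require Import all_classical all_reals all_analysis.
From mathcomp Require Import measurable_realfun.

Set Implicit Arguments.
Unset Strict Implicit.
Unset Printing Implicit Defensive.

Import Order.TTheory GRing.Theory Num.Theory.
Import numFieldNormedType.Exports.

Local Open Scope classical_set_scope.
Local Open Scope ring_scope.

(** * Linear algebra *)

Definition posdefmx (R : realType) (n : nat) (B : 'M[R]_n) : Prop :=
  B^T = B /\ forall x : 'cV[R]_n, x != 0 -> 0 < (x^T *m B *m x) 0 0.

(** For positive semidefinite [M] this is a seminorm.  In general [Num.sqrt]
    sends negative numbers to 0. *)
Definition mnorm (R : realType) (n : nat) (M : 'M[R]_n) (x : 'cV[R]_n) : R :=
  Num.sqrt ((x^T *m M *m x) 0 0).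

Definition is_posdef_sqrt (R : realType) (n : nat) (B C : 'M[R]_n) : Prop :=
  posdefmx C /\ C *m C = B.

Definition penrose (R : realType) (p q : nat) (M : 'M[R]_(p, q))
    (X : 'M[R]_(q, p)) : Prop :=
  [/\ M *m X *m M = M, X *m M *m X = X,
      (M *m X)^T = M *m X & (X *m M)^T = X *m M].

Definition mpinv (R : realType) (p q : nat) (M : 'M[R]_(p, q)) : 'M[R]_(q, p) :=
  xget 0 [set X | penrose M X].

Lemma gram_unitmx (R : realType) (p q : nat) (F : 'M[R]_(p, q)) :
  row_free F -> F *m F^T \in unitmx.
Proof.
move=> Ffree; rewrite -row_free_unit -kermx_eq0; apply/eqP/row_matrixP => i.
rewrite row0; set u := row i _.
have uFF : u *m (F *m F^T) = 0 by rewrite -row_mul mulmx_ker row0.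
apply: (row_free_inj Ffree); rewrite mul0mx; set v := u *m F.
have vv0 : (v *m v^T) 0 0 = 0 by rewrite trmx_mul mulmxA -(mulmxA u) uFF mul0mx mxE.
have /psumr_eq0P v0 : \sum_j v 0 j ^+ 2 = 0.
  by rewrite -[RHS]vv0 mxE; apply: eq_bigr => j _; rewrite [v^T _ _]mxE -expr2.
apply/rowP => j; rewrite [RHS]mxE; apply/eqP; rewrite -sqrf_eq0.
by rewrite v0 // => k _; exact: sqr_ge0.
Qed.

Lemma mpinvP (R : realType) (p q : nat) (M : 'M[R]_(p, q)) :
  penrose M (mpinv M).
Proof.
have [k [C [F [<- Cfull Ffree]]]] : exists (k : nat) (C : 'M[R]_(p, k)) (F : 'M[R]_(k, q)),
    [/\ C *m F = M, row_full C & row_free F].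
  exists (\rank M), (col_base M), (row_base M).
  by rewrite mulmx_base col_base_full row_base_free.
have FFu : F *m F^T \in unitmx by exact: gram_unitmx.
have CCu : C^T *m C \in unitmx.
  by rewrite -{2}(trmxK C); apply: gram_unitmx; rewrite /row_free mxrank_tr.
pose X := F^T *m invmx (F *m F^T) *m (invmx (C^T *m C) *m C^T).
have MX : C *m F *m X = C *m invmx (C^T *m C) *m C^T.
  by rewrite /X !mulmxA -(mulmxA C F) (mulmxK FFu).
have XM : X *m (C *m F) = F^T *m invmx (F *m F^T) *m F.
  by rewrite /X -!mulmxA (mulmxA C^T) (mulKmx CCu).
apply: (@xgetPex _ 0 [set Y | penrose (C *m F) Y]); exists X; split.
- by rewrite MX -!mulmxA (mulmxA C^T) (mulKmx CCu).
- by rewrite XM /X !mulmxA -(mulmxA _ F) (mulmxKV FFu).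
- by rewrite MX !trmx_mul trmxK trmx_inv trmx_mul trmxK mulmxA.
- by rewrite XM !trmx_mul trmxK trmx_inv trmx_mul trmxK mulmxA.
Qed.

Definition is_min_nonzero_eigenvalue (R : realType) (n : nat) (W : 'M[R]_n)
    (l : R) : Prop :=
  [/\ eigenvalue W l, l != 0 &
      forall a : R, eigenvalue W a -> a != 0 -> l <= a].

Definition argmin_on (R : realType) (T : Type) (L : set T) (g : T -> R) : set T :=
  [set x | L x /\ forall y, L y -> g x <= g y].

(** * Random matrices *)

(** The σ-algebra on [p x q] matrices generated by the entries. *)
Section measurable_matrix.
Context (R : realType) (p q : nat).

Definition mx_cylinders : set (set 'M[R]_(p, q)) :=
  [set U | exists i j (V : set R),
     measurable V /\ U = [set M : 'M[R]_(p, q) | V (M i j)]].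

HB.instance Definition _ :=
  @isMeasurable.Build (sigma_display mx_cylinders) 'M[R]_(p, q)
    <<s mx_cylinders >> (@sigma_algebra0 _ setT mx_cylinders)
    (@sigma_algebraC _ mx_cylinders) (@sigma_algebra_bigcup _ setT mx_cylinders).

End measurable_matrix.

(** Real matrices with [m] rows and an arbitrary number of columns, with the
    disjoint-union σ-algebra: a distribution on this type may have a random
    number of columns. *)
Definition rowsmx (R : realType) (m : nat) := {q : nat & 'M[R]_(m, q)}.

Definition ncols (R : realType) (m : nat) (S : rowsmx R m) : nat := projT1 S.

Definition mxof (R : realType) (m : nat) (S : rowsmx R m) : 'M[R]_(m, ncols S) :=
  projT2 S.

Definition rowsmx_measurable (R : realType) (m : nat) : set (set (rowsmx R m)) :=
  [set U | forall q : nat,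
     measurable [set M : 'M[R]_(m, q) | U (existT _ q M)]].

Section measurable_rowsmx.
Context (R : realType) (m : nat).

HB.instance Definition _ := Choice.on (rowsmx R m).
HB.instance Definition _ :=
  isPointed.Build (rowsmx R m) (existT (fun q => 'M[R]_(m, q)) 0%N 0).

Let rowsmx_measurable0 : rowsmx_measurable (set0 : set (rowsmx R m)).
Proof. by move=> q; exact: measurable0. Qed.

Let rowsmx_measurableC (U : set (rowsmx R m)) :
  rowsmx_measurable U -> rowsmx_measurable (~` U).
Proof. by move=> mU q; exact: (measurableC (mU q)). Qed.

Let rowsmx_measurable_bigcup (U : (set (rowsmx R m))^nat) :
  (forall i, rowsmx_measurable (U i)) -> rowsmx_measurable (\bigcup_i U i).
Proof. by move=> mU q; exact: (bigcup_measurable (fun i _ => mU i q)). Qed.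

HB.instance Definition _ :=
  @isMeasurable.Build default_measure_display (rowsmx R m)
    (@rowsmx_measurable R m) rowsmx_measurable0 rowsmx_measurableC
    rowsmx_measurable_bigcup.

End measurable_rowsmx.

(** A column vector whose dimension may be random; it is stored as a row
    because in [rowsmx] it is the number of columns that varies. *)
Definition rowof (R : realType) (q : nat) (v : 'cV[R]_q) : rowsmx R 1 :=
  existT (fun p => 'M[R]_(1, p)) q v^T.

(** * Independence and conditional expectation *)

Definition indep (d : measure_display) (T : measurableType d) (R : realType)
    (P : probability T R) (F G : set (set T)) : Prop :=
  forall U V, F U -> G V -> P (U `&` V) = (P U * P V)%E.

(** [V] is a version of the conditional expectation of the nonnegative [Y]
    given the sub-σ-algebra [G]. *)
Definition is_condexp (d : measure_display) (T : measurableType d)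
    (R : realType) (P : probability T R) (G : set (set T))
    (Y V : T -> \bar R) : Prop :=
  (forall U : set (\bar R), measurable U -> G (V @^-1` U)) /\
  (forall E : set T, G E -> \int[P]_(w in E) V w = \int[P]_(w in E) Y w)%E.

(** * The sketched problem *)

Section sketching.
Context (R : realType) (m n : nat).
Variables (A : 'M[R]_(m, n)) (b : 'cV[R]_m) (B : 'M[R]_n).

Definition solset : set 'cV[R]_n := [set x | A *m x = b].

Definition sketchM (S : rowsmx R m) : 'M[R]_(ncols S) :=
  (mxof S)^T *m A *m invmx B *m A^T *m mxof S.

Definition sketchH (S : rowsmx R m) : 'M[R]_m :=
  mxof S *m mpinv (sketchM S) *m (mxof S)^T.

Definition sketchZ (S : rowsmx R m) : 'M[R]_n := A^T *m sketchH S *m A.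

Definition sketchf (S : rowsmx R m) (x : 'cV[R]_n) : R :=
  2^-1 * ((A *m x - b)^T *m sketchH S *m (A *m x - b)) 0 0.

(** Right-hand side and least norm solution of the system solved at [x]. *)
Definition sketchd (S : rowsmx R m) (x : 'cV[R]_n) : 'cV[R]_(ncols S) :=
  (mxof S)^T *m (b - A *m x).

Definition sketch_lambda (S : rowsmx R m) (x : 'cV[R]_n) : 'cV[R]_(ncols S) :=
  mpinv (sketchM S) *m sketchd S x.

Variable D : probability (rowsmx R m) R.

(** [fine] is harmless under the integrability assumption below. *)
Definition stochf (x : 'cV[R]_n) : R := fine 'E_D[fun S => sketchf S x].

Definition meanZ : 'M[R]_n :=
  \matrix_(i, j) fine 'E_D[fun S => sketchZ S i j].

Definition expectations_exist : Prop :=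
  (forall i j, D.-integrable setT (fun S => (sketchZ S i j)%:E)) /\
  (forall x, D.-integrable setT (fun S => (sketchf S x)%:E)).

(** [C] is the square root of [B]. *)
Definition meanW (C : 'M[R]_n) : 'M[R]_n := invmx C *m meanZ *m invmx C.

(** * iBasic *)

Context (d : measure_display) (T : measurableType d) (P : probability T R).
Variables (omega : R) (x0 : 'cV[R]_n).
Variables (S : nat -> T -> rowsmx R m).
Variables (lam : forall (k : nat) (w : T), 'cV[R]_(ncols (S k w))).
Variables (x : nat -> T -> 'cV[R]_n).

(** The σ-algebra generated by [x_0, ..., x_k] and by the samples and inexact
    solutions of the iterations before [k]. *)
Definition past (k : nat) : set (set T) :=
  <<s \bigcup_(j in [set j | (j <= k)%N]) g_sigma_algebra_preimage (x j) `|`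
      \bigcup_(j in [set j | (j < k)%N])
        (g_sigma_algebra_preimage (S j) `|`
         g_sigma_algebra_preimage (fun w => rowof (lam j w))) >>.

(** The σ-algebra generated by [(x_k, S_k)]. *)
Definition current (k : nat) : set (set T) :=
  <<s g_sigma_algebra_preimage (x k) `|` g_sigma_algebra_preimage (S k) >>.

(** [S], [lam], [x] are the samples, inexact solutions and iterates of a run
    on the probability space [P], which also carries the internal randomness
    of the method producing [lam]. *)
Record iBasic : Prop := {
  iBasic_stepsize : 0 < omega;
  iBasic_measurable_S : forall k, measurable_fun setT (S k);
  iBasic_measurable_lam :
    forall k, measurable_fun setT (fun w => rowof (lam k w));
  iBasic_measurable_x : forall k, measurable_fun setT (x k);
  iBasic_law : forall k (U : set (rowsmx R m)), measurable U ->
    P (S k @^-1` U) = D U;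
  iBasic_fresh : forall k,
    indep P (g_sigma_algebra_preimage (S k)) (past k);
  iBasic_init : forall w, x 0%N w = x0;
  iBasic_step : forall k w,
    x k.+1 w =
      x k w + omega *: (invmx B *m A^T *m mxof (S k w) *m lam k w) }.

End sketching.

(* Main.v *)
(** Put [e_k = x_k - x_*], [Z_k = sketchZ A B S_k] and
    [lambda_k^* = sketch_lambda A b B S_k x_k].  The exact step projects [e_k]
    [B]-orthogonally and lowers its squared norm by [e_k^T Z_k e_k]; the
    inexactness only adds a vector of the subspace projected away, so
      [|e_(k+1)|_B^2 + e_k^T Z_k e_k
         = |e_k|_B^2 + |lambda_k^r - lambda_k^*|_(M_k)^2].
    For [lambda_k^0 = 0] the last term equals [e_k^T Z_k e_k], so its expectation
    after [r] inner steps is at most [theta^r E(e_k^T Z_k e_k)].  As [S_k] is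
    independent of [x_k], [E(e_k^T Z_k e_k) = E(e_k^T E(Z) e_k)].  Finally [e_0]
    lies in the range of [B^-1 A^T] because [x_*] is a projection, and every step
    preserves this; by exactness [B^(1/2)] maps that range into the range of
    [W], where the Rayleigh quotient of [W] is at least [lambda_min^+]. *)

From HB Require Import structures.
Require Import Defs.
From mathcomp Require Import all_boot all_order all_algebra.
From mathcomp Require Import all_classical all_reals all_analysis.
From mathcomp Require Import measurable_realfun.
From mathcomp Require Import ring lra.
From mathcomp Require complex.

Set Implicit Arguments.
Unset Strict Implicit.
Unset Printing Implicit Defensive.

Import Order.TTheory GRing.Theory Num.Theory.
Import numFieldNormedType.Exports.

Local Open Scope classical_set_scope.
Local Open Scope ring_scope.

(** * Linear algebra *)

Section spectral.
Import complex.
Local Open Scope sesquilinear_scope.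

Lemma diag_quadE (C : numClosedFieldType) (n : nat) (u e : 'rV[C]_n) :
  (u *m diag_mx e *m u^t*) 0 0 = \sum_i e 0 i * `|u 0 i| ^+ 2.
Proof.
rewrite mxE; apply: eq_bigr => i _.
by rewrite mul_mx_diag !mxE normCK mulrCA mulrA.
Qed.

(** For hermitian [W] the vectors [w *m W] are exactly those orthogonal to the
    kernel, where the zero eigenvalues play no role. *)
Lemma hermitian_rayleigh (C : numClosedFieldType) (n : nat) (W : 'M[C]_n)
    (l : C) :
  W \is hermsymmx ->
  (forall a, a \is Num.real -> eigenvalue W a -> a != 0 -> l <= a) ->
  forall w : 'rV[C]_n,
    l * (w *m W *m (w *m W)^t*) 0 0 <= (w *m W *m W *m (w *m W)^t*) 0 0.
Proof.
move=> Wherm lmin w.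
have dreal := hermitian_spectral_diag_real Wherm.
have /hermitian_normalmx/orthomx_spectralP := Wherm.
set U := spectralmx W; set d := spectral_diag W in dreal *.
have Uu : U \is unitarymx by exact: spectral_unitarymx.
rewrite invmx_unitary// => WE.
(* Row [i] of [U] is an eigenvector of [W] for [d 0 i]; it is nonzero because the rows of a unitary
   matrix have norm one. *)
have d_eig i : d 0 i = 0 \/ l <= d 0 i.
  have [->|d0] := eqVneq (d 0 i) 0; [by left|right; apply: lmin => //].
    exact: mxOverP.
  apply/eigenvalueP; exists (row i U).
    rewrite -row_mul WE mulmxA mulmxA (unitarymxP Uu) mul1mx row_mul.
    by rewrite row_diag_mx -scalemxAl -rowE.
  apply/eqP => Ui0; have /row_unitarymxP/(_ i i) := Uu.
  by rewrite Ui0 linear0l eqxx => /eqP; rewrite eq_sym oner_eq0.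
pose u := w *m U^t*.
have vE : w *m W = u *m diag_mx d *m U by rewrite {1}WE /u !mulmxA.
have dt : (diag_mx d)^t* = diag_mx d.
  by rewrite tr_diag_mx map_diag_mx (realmxC dreal).
have vtE : (w *m W)^t* = U^t* *m (diag_mx d *m u^t*).
  by rewrite vE !trmx_mul !map_mxM dt.
have vWE : w *m W *m W = u *m (diag_mx d *m diag_mx d) *m U.
  by rewrite vE {1}WE !mulmxA mulmxtVK.
rewrite vtE vWE vE !mulmxA !mulmxtVK//.
rewrite -!(mulmxA u) !mulmx_diag !mulmxA !diag_quadE.
(* In eigencoordinates the two sides are the sums of [l d_i^2 |u_i|^2] and of [d_i^3 |u_i|^2],
   compared term by term. *)
rewrite mulr_sumr; apply: ler_sum => i _; rewrite !mxE mulrA.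
apply: ler_wpM2r; first by rewrite exprn_ge0.
have [->|le_ld] := d_eig i; first by rewrite !mulr0.
rewrite -[leRHS]mulrA; apply: ler_wpM2r => //.
by rewrite -expr2 real_exprn_even_ge0// (mxOverP dreal).
Qed.

(** The complexification of [W] is hermitian and has the same real eigenvalues, so the complex bound
    restricts to real vectors. *)
Lemma symmetric_rayleigh (R : rcfType) (n : nat) (W : 'M[R]_n) (l : R) :
  W^T = W -> (forall a, eigenvalue W a -> a != 0 -> l <= a) ->
  forall w : 'rV[R]_n,
    l * (w *m W *m (w *m W)^T) 0 0 <= (w *m W *m W *m (w *m W)^T) 0 0.
Proof.
move=> Wsym lmin w; pose f : {rmorphism R -> R[i]} := real_complex R.
have freals p q (M : 'M[R]_(p, q)) : map_mx f M \is a mxOver Num.real.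
  by apply/mxOverP => i j; rewrite mxE; apply/complex_realP; exists (M i j).
have Wherm : map_mx f W \is hermsymmx.
  apply/is_hermitianmxP; rewrite expr0 scale1r map_trmx Wsym.
  by rewrite (realmxC (freals _ _ _)).
have lminc a : a \is Num.real -> eigenvalue (map_mx f W) a -> a != 0 -> f l <= a.
  move=> /complex_realP[b ->]; rewrite lecR (eigenvalue_map f) => Wb b0.
  by apply: lmin => //; apply: contra_neq b0 => ->.
have vtE : (map_mx f (w *m W))^t* = map_mx f (w *m W)^T.
  by rewrite map_trmx (realmxC (freals _ _ _)).
have := hermitian_rayleigh Wherm lminc (map_mx f w).
by rewrite -!map_mxM vtE -!map_mxM !mxE -(rmorphM f) lecR.
Qed.

End spectral.

Definition quad (R : realType) (n : nat) (M : 'M[R]_n) (v : 'cV[R]_n) : R :=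
  (v^T *m M *m v) 0 0.

Lemma quadE (R : realType) (n : nat) (M : 'M[R]_n) (v : 'cV[R]_n) :
  quad M v = \sum_i \sum_j v j 0 * M j i * v i 0.
Proof.
rewrite /quad mxE; apply: eq_bigr => i _; rewrite mxE big_distrl /=.
by apply: eq_bigr => j _; rewrite !mxE.
Qed.

Lemma trmx11 (R : realType) (M : 'M[R]_1) : M^T = M.
Proof. by apply/matrixP => i j; rewrite !ord1 mxE. Qed.

Lemma quadD (R : realType) (n : nat) (M : 'M[R]_n) (u v : 'cV[R]_n) :
  M^T = M -> quad M (u + v) = quad M u + (u^T *m M *m v) 0 0 *+ 2 + quad M v.
Proof.
move=> Msym; have uv : v^T *m M *m u = u^T *m M *m v.
  by rewrite -[LHS]trmx11 !trmx_mul trmxK Msym mulmxA.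
rewrite /quad [(u + v)^T]linearD /= !mulmxDl !mulmxDr uv.
by rewrite !mxE; ring.
Qed.

Lemma quadZ (R : realType) (n : nat) (M : 'M[R]_n) (a : R) (v : 'cV[R]_n) :
  quad M (a *: v) = a ^+ 2 * quad M v.
Proof. by rewrite /quad [(a *: v)^T]linearZ /= -!scalemxAl -scalemxAr !mxE; ring. Qed.

(** * Positive definite forms *)

Section posdef.
Context (R : realType) (n : nat) (B : 'M[R]_n).
Hypothesis Bpos : posdefmx B.

Lemma posdefmx_quad_ge0 (v : 'cV[R]_n) : 0 <= quad B v.
Proof.
have [->|/(proj2 Bpos)/ltW//] := eqVneq v 0.
by rewrite /quad mulmx0 mxE.
Qed.

Lemma posdefmx_quad_eq0 (v : 'cV[R]_n) : quad B v = 0 -> v = 0.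
Proof.
by move=> v0; apply/eqP; apply: contra_eqT v0 => /(proj2 Bpos) /lt0r_neq0.
Qed.

Lemma posdefmx_unit : B \in unitmx.
Proof.
rewrite -row_free_unit -kermx_eq0; apply/eqP/row_matrixP => i; rewrite row0.
apply: trmx_inj; rewrite trmx0; apply: posdefmx_quad_eq0.
by rewrite /quad trmxK -row_mul mulmx_ker row0 mul0mx mxE.
Qed.

Lemma invmx_sym : (invmx B)^T = invmx B.
Proof. by rewrite trmx_inv (proj1 Bpos). Qed.

Lemma posdefmx_inv : posdefmx (invmx B).
Proof.
split; first exact: invmx_sym.
move=> x x0; have Bx0 : invmx B *m x != 0.
  by apply: contra_neq x0 => Bx0; rewrite -(mulKVmx posdefmx_unit x) Bx0 mulmx0.
have := proj2 Bpos _ Bx0.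
by rewrite trmx_mul invmx_sym -!mulmxA (mulmxA B) mulmxV ?posdefmx_unit// mul1mx.
Qed.

Lemma mnorm_sqr (v : 'cV[R]_n) : mnorm B v ^+ 2 = quad B v.
Proof. by rewrite /mnorm sqr_sqrtr// posdefmx_quad_ge0. Qed.

(** * Algebra of one sketched step, with [F] for [A^T S] and [X] for a pseudoinverse of [M] *)

Section sketch.
Context (q : nat) (F : 'M[R]_(n, q)) (X : 'M[R]_q).
Let M := F^T *m invmx B *m F.
Hypothesis XP : penrose M X.

Lemma gram_sym : M^T = M.
Proof. by rewrite /M !trmx_mul trmxK invmx_sym mulmxA. Qed.

Lemma quad_gram (l : 'cV[R]_q) : quad M l = quad B (invmx B *m F *m l).
Proof.
rewrite /quad !trmx_mul invmx_sym /M !mulmxA.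
by rewrite (mulmxKV posdefmx_unit).
Qed.

Lemma gram_mpinvK : M *m X *m F^T = F^T.
Proof.
case: XP => MXM _ _ _.
(* [K B^-1 F = 0] gives [K B^-1 K^T = 0], and [B^-1] is positive definite. *)
pose K := F^T - M *m X *m F^T.
have KF : K *m invmx B *m F = 0.
  have -> : K *m invmx B *m F = M - M *m X *m M.
    by rewrite /K !mulmxBl /M !mulmxA.
  by rewrite MXM subrr.
have KK : K *m invmx B *m K^T = 0.
  rewrite /K linearB /= trmxK mulmxBr -/K KF sub0r !trmx_mul trmxK.
  by rewrite !mulmxA KF !mul0mx oppr0.
suff : K = 0 by move/subr0_eq.
apply/row_matrixP => i; rewrite row0.
apply: trmx_inj; rewrite trmx0; apply/eqP; apply: contraT => Ki.
have := proj2 posdefmx_inv _ Ki.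
by rewrite trmxK -row_mul tr_row colE mulmxA -row_mul KK row0 mul0mx mxE ltxx.
Qed.

(** By [gram_mpinvK], [F X^T F^T] equals [F X^T M X F^T], which is visibly symmetric since [M]
    is. *)
Lemma sketch_sym : (F *m X *m F^T)^T = F *m X *m F^T.
Proof.
have E : F *m X^T *m F^T = F *m (X^T *m M *m X) *m F^T.
  by rewrite -[in LHS]gram_mpinvK !mulmxA.
have S : (F *m X^T *m F^T)^T = F *m X^T *m F^T.
  by rewrite E; move: (M) gram_sym => N Ns; rewrite !trmx_mul !trmxK Ns !mulmxA.
by rewrite !trmx_mul trmxK mulmxA -S !trmx_mul !trmxK mulmxA.
Qed.

Lemma quad_sketch (e : 'cV[R]_n) :
  quad (F *m X *m F^T) e = quad M (X *m (F^T *m e)).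
Proof.
rewrite /quad -[in LHS]sketch_sym !trmx_mul !trmxK.
by rewrite -[in LHS]gram_mpinvK !mulmxA.
Qed.

(** Both squares expand with the same cross term [2 e^T F l]: on the left [B] cancels its inverse,
    on the right [M X F^T = F^T]. *)
Lemma sketch_step (e : 'cV[R]_n) (l : 'cV[R]_q) :
  quad B (e + invmx B *m F *m l) + quad (F *m X *m F^T) e =
  quad B e + quad M (l + X *m (F^T *m e)).
Proof.
rewrite (quadD _ _ (proj1 Bpos)) (quadD _ _ gram_sym) -quad_gram -quad_sketch.
have -> : e^T *m B *m (invmx B *m F *m l) = e^T *m F *m l.
  by rewrite !mulmxA (mulmxK posdefmx_unit).
have -> : l^T *m M *m (X *m (F^T *m e)) = e^T *m F *m l.
  transitivity (l^T *m (M *m X *m F^T) *m e); first by rewrite !mulmxA.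
  by rewrite gram_mpinvK -[LHS]trmx11 !trmx_mul !trmxK mulmxA.
by ring.
Qed.

Lemma quad_sketch_ge0 (e : 'cV[R]_n) : 0 <= quad (F *m X *m F^T) e.
Proof. by rewrite quad_sketch quad_gram posdefmx_quad_ge0. Qed.

Lemma quad_sketch_le (e : 'cV[R]_n) : quad (F *m X *m F^T) e <= quad B e.
Proof.
(* This is the multiplier of the exact step: it annihilates the last term of [sketch_step], so
   [quad B e] is the sketched form plus a nonnegative remainder. *)
have := sketch_step e (- (X *m (F^T *m e))).
rewrite addNr {4}/quad mulmx0 mxE addr0 => <-.
by rewrite lerDr posdefmx_quad_ge0.
Qed.

End sketch.
End posdef.

(** The columns of [cokermx A] lie in the kernel of [A], and being killed by [cokermx A]
    characterises the row space of [A]. *)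
Lemma submx_ker (F : fieldType) (m n p : nat) (A : 'M[F]_(m, n))
    (v : 'M[F]_(p, n)) :
  (forall u : 'cV[F]_n, A *m u = 0 -> v *m u = 0) -> (v <= A)%MS.
Proof.
move=> vker; rewrite submxE; apply/eqP/trmx_inj/row_matrixP => i.
rewrite trmx0 row0 -tr_col colE -mulmxA vker ?trmx0//.
by rewrite mulmxA mulmx_coker mul0mx.
Qed.

(** First-order optimality: moving [xstar] along the kernel of [A] stays in [solset], so [e] is
    [B]-orthogonal to that kernel and [e^T B] lies in the row space of [A]. *)
Lemma argmin_mnorm_range (R : realType) (m n : nat) (A : 'M[R]_(m, n))
    (b : 'cV[R]_m) (B : 'M[R]_n) (x0 xstar : 'cV[R]_n) :
  posdefmx B -> argmin_on (solset A b) (fun z => mnorm B (z - x0)) xstar ->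
  exists y, x0 - xstar = invmx B *m A^T *m y.
Proof.
move=> Bpos [Axstar xmin]; set e := x0 - xstar.
have orth (u : 'cV[R]_n) : A *m u = 0 -> (e^T *m B) *m u = 0.
  move=> Au; pose p : R := (e^T *m B *m u) 0 0.
  have [->|u0] := eqVneq u 0; first by rewrite mulmx0.
  have q_gt0 : 0 < quad B u by exact: (proj2 Bpos).
  (* [t] minimizes [quad B (e + t *: u)]. *)
  pose t := - (p / quad B u).
  have : quad B e <= quad B (e + t *: u).
    have Az : solset A b (xstar - t *: u).
      by rewrite /solset /= mulmxBr -scalemxAr Au scaler0 subr0.
    rewrite -!(mnorm_sqr Bpos) ler_sqr ?nnegrE ?sqrtr_ge0//.
    have mnormN v : mnorm B (- v) = mnorm B v.
      by rewrite /mnorm [(- v)^T]linearN /= mulNmx mulmxN mulNmx opprK.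
    have -> : e = - (xstar - x0) by rewrite opprB.
    have -> : - (xstar - x0) + t *: u = - (xstar - t *: u - x0).
      by rewrite !opprB addrA addrAC.
    by rewrite !mnormN; exact: xmin.
  rewrite (quadD _ _ (proj1 Bpos)) quadZ -scalemxAr mxE -/p -addrA lerDl.
  have -> : t * p *+ 2 + t ^+ 2 * quad B u = - (p ^+ 2 / quad B u).
    by rewrite /t; field; rewrite gt_eqF.
  rewrite oppr_ge0 pmulr_lle0 ?invr_gt0// => p2.
  have /eqP : p ^+ 2 = 0 by apply: le_anti; rewrite p2 sqr_ge0.
  by rewrite sqrf_eq0 => /eqP p0; apply/matrixP => i j; rewrite !ord1 [RHS]mxE.
have /submxP[y ye] := submx_ker orth; exists y^T.
rewrite -[_ *m A^T *m _]mulmxA -trmx_mul -ye trmx_mul trmxK (proj1 Bpos).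
by rewrite mulKmx// (posdefmx_unit Bpos).
Qed.

(** * Spectral bounds after the change of variable by [C], the square root of [B] *)

Section rayleigh.
Context (R : realType) (n : nat) (B C Z : 'M[R]_n) (l : R).
Hypotheses (Bpos : posdefmx B) (Csqrt : is_posdef_sqrt B C) (Zsym : Z^T = Z).
Let W := invmx C *m Z *m invmx C.
Hypothesis lP : is_min_nonzero_eigenvalue W l.

Let Cpos : posdefmx C. Proof. by case: Csqrt. Qed.
Let CC : C *m C = B. Proof. by case: Csqrt. Qed.
Let Cu : C \in unitmx. Proof. exact: posdefmx_unit. Qed.
Let Csym : C^T = C. Proof. by case: Cpos. Qed.

(** In the variable [C e] the two forms become those of the identity and of [W]. If [W u = 0] then
    [Z C^-1 u = 0], so [A C^-1 u = 0]; hence [(C e)^T], which is [y^T A C^-1], lies in the row space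
    of [W] and [symmetric_rayleigh] applies. *)
Lemma rayleigh_range (m : nat) (A : 'M[R]_(m, n)) (e : 'cV[R]_n) :
  (forall u : 'cV[R]_n, Z *m u = 0 -> A *m u = 0) ->
  (exists y, e = invmx B *m A^T *m y) -> l * quad B e <= quad Z e.
Proof.
move=> kerZ [y ey]; case: lP => _ _ lmin.
have Wsym : W^T = W by rewrite /W !trmx_mul Zsym (invmx_sym Cpos) mulmxA.
have BC : invmx B *m C = invmx C.
  apply: (can_inj (mulKmx (posdefmx_unit Bpos))).
  by rewrite mulKVmx ?posdefmx_unit// -CC -mulmxA mulmxV// mulmx1.
have CeE : (C *m e)^T = y^T *m A *m invmx C.
  by rewrite ey !trmx_mul trmxK (invmx_sym Bpos) Csym -!mulmxA BC.
have /submxP[w we] : ((C *m e)^T <= W)%MS.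
  apply: submx_ker => u Wu; rewrite CeE -!mulmxA kerZ ?mulmx0//.
  have -> : Z *m (invmx C *m u) = C *m (W *m u).
    by rewrite /W !mulmxA mulmxV// mul1mx.
  by rewrite Wu mulmx0.
have := symmetric_rayleigh Wsym lmin w; rewrite -we trmxK.
by rewrite trmx_mul Csym /quad -CC /W !mulmxA !(mulmxK Cu) !(mulmxKV Cu).
Qed.

(** The vector is [C^-1 w^T] for an eigenvector [w] of [W]; it transfers bounds on the form of [Z]
    to [l]. *)
Lemma min_eigenvalue_quad :
  exists2 e : 'cV[R]_n, e != 0 & quad Z e = l * quad B e.
Proof.
case: lP => /eigenvalueP[w wW w0] _ _.
exists (invmx C *m w^T).
  apply: contra_neq w0 => e0; apply: trmx_inj.
  by rewrite trmx0 -(mulKVmx Cu w^T) e0 mulmx0.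
transitivity ((w *m W *m w^T) 0 0).
  by rewrite /quad trmx_mul trmxK (invmx_sym Cpos) /W !mulmxA.
rewrite wW -scalemxAl mxE; congr (_ * _).
rewrite /quad trmx_mul trmxK (invmx_sym Cpos) -CC !mulmxA (mulmxKV Cu).
by rewrite (mulmxK Cu).
Qed.

End rayleigh.

(** * Sketched quantities expressed through the error [x - xstar] *)

Section sketch_quad.
Context (R : realType) (m n : nat) (A : 'M[R]_(m, n)) (B : 'M[R]_n).
Hypothesis Bpos : posdefmx B.
Implicit Type S : rowsmx R m.

Lemma sketchME S :
  sketchM A B S = (A^T *m mxof S)^T *m invmx B *m (A^T *m mxof S).
Proof. by rewrite /sketchM trmx_mul trmxK !mulmxA. Qed.

Lemma sketchZE S : sketchZ A B S =
  (A^T *m mxof S) *m mpinv (sketchM A B S) *m (A^T *m mxof S)^T.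
Proof. by rewrite /sketchZ /sketchH trmx_mul trmxK !mulmxA. Qed.

Let sketchP S : penrose ((A^T *m mxof S)^T *m invmx B *m (A^T *m mxof S))
  (mpinv (sketchM A B S)).
Proof. by rewrite sketchME; exact: mpinvP. Qed.

Lemma sketchZ_sym S : (sketchZ A B S)^T = sketchZ A B S.
Proof. by rewrite sketchZE; exact: (sketch_sym Bpos (sketchP S)). Qed.

Lemma quad_sketchZ_ge0 S e : 0 <= quad (sketchZ A B S) e.
Proof. by rewrite sketchZE; exact: (quad_sketch_ge0 Bpos (sketchP S)). Qed.

Lemma quad_sketchZ_le S e : quad (sketchZ A B S) e <= quad B e.
Proof. by rewrite sketchZE; exact: (quad_sketch_le Bpos (sketchP S)). Qed.

Lemma mnorm_sketchM_sqr S l :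
  mnorm (sketchM A B S) l ^+ 2 = quad (sketchM A B S) l.
Proof.
rewrite /mnorm sqr_sqrtr// -/(quad _ _) sketchME (quad_gram Bpos).
exact: posdefmx_quad_ge0.
Qed.

Context (b : 'cV[R]_m) (xstar : 'cV[R]_n).
Hypothesis Axstar : A *m xstar = b.

(** As [b = A xstar], the least norm solution is minus the vector [X F^T e] of [sketch_step];
    subtracting it yields the sum occurring there. *)
Let lambdaE S x : sketch_lambda A b B S x =
  - (mpinv (sketchM A B S) *m ((A^T *m mxof S)^T *m (x - xstar))).
Proof.
rewrite /sketch_lambda /sketchd -Axstar -mulmxBr -opprB !mulmxN.
by rewrite trmx_mul trmxK !mulmxA.
Qed.

Lemma iBasic_step_quad S x l :
  quad B (x + invmx B *m A^T *m mxof S *m l - xstar)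
    + quad (sketchZ A B S) (x - xstar) =
  quad B (x - xstar)
    + mnorm (sketchM A B S) (l - sketch_lambda A b B S x) ^+ 2.
Proof.
rewrite mnorm_sketchM_sqr lambdaE opprK addrAC -[_ *m A^T *m _]mulmxA.
by rewrite sketchZE (sketch_step Bpos (sketchP S)) -sketchME.
Qed.

Lemma mnorm_sketch_lambda S x :
  mnorm (sketchM A B S) (0 - sketch_lambda A b B S x) ^+ 2 =
  quad (sketchZ A B S) (x - xstar).
Proof.
rewrite mnorm_sketchM_sqr lambdaE opprK add0r sketchZE.
by rewrite (quad_sketch Bpos (sketchP S)) -sketchME.
Qed.

Lemma sketchfE S x : sketchf A b B S x = 2^-1 * quad (sketchZ A B S) (x - xstar).
Proof.
by rewrite /sketchf -Axstar -mulmxBr /quad /sketchZ trmx_mul !mulmxA.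
Qed.

End sketch_quad.

(** * Measure and integration *)

Lemma measurable_mxentry (R : realType) (p q : nat) (i : 'I_p) (j : 'I_q) :
  measurable_fun setT (fun M : 'M[R]_(p, q) => M i j).
Proof.
move=> _ V mV; rewrite setTI; apply: sub_sigma_algebra.
by exists i, j, V.
Qed.

Lemma measurable_quad (d : measure_display) (T : measurableType d)
    (R : realType) (n : nat) (Z : T -> 'M[R]_n) (v : T -> 'cV[R]_n) :
  (forall i j, measurable_fun setT (fun w => Z w i j)) ->
  (forall i, measurable_fun setT (fun w => v w i 0)) ->
  measurable_fun setT (fun w => quad (Z w) (v w)).
Proof.
move=> mZ mv; under eq_fun do rewrite quadE.
apply: measurable_sum => i; apply: measurable_sum => j.
by apply: measurable_funM => //; apply: measurable_funM.
Qed.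

Lemma integral_quad (d : measure_display) (T : measurableType d)
    (R : realType) (P : probability T R) (n : nat) (Z : T -> 'M[R]_n)
    (v : 'cV[R]_n) :
  (forall i j, P.-integrable setT (fun w => (Z w i j)%:E)) ->
  (\int[P]_w (quad (Z w) v)%:E =
   (quad (\matrix_(i, j) fine 'E_P[fun w => Z w i j]) v)%:E)%E.
Proof.
move=> iZ.
have iZv i j : P.-integrable setT (fun w => (v j 0 * v i 0)%:E * (Z w j i)%:E)%E.
  exact: integrableZl.
under eq_integral do rewrite quadE.
transitivity (\int[P]_w \sum_i \sum_j ((v j 0 * v i 0)%:E * (Z w j i)%:E))%E.
  apply: eq_integral => w _; rewrite -sumEFin; apply: eq_bigr => i _.
  by rewrite -sumEFin; apply: eq_bigr => j _; rewrite -EFinM; congr EFin; ring.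
rewrite integral_sum//; last by move=> i; exact: integrable_sum.
rewrite quadE -sumEFin; apply: eq_bigr => i _.
rewrite integral_sum// -sumEFin; apply: eq_bigr => j _.
rewrite integralZl// mxE unlock mulrAC [in RHS]EFinM fineK//.
exact: integrable_fin_num.
Qed.

(** On rectangles the law of [(X, Y)] is the product of the law of [X] with [D]; uniqueness of
    product measures and Tonelli do the rest. *)
Lemma integral_indep (d d1 d2 : measure_display) (T : measurableType d)
    (T1 : measurableType d1) (T2 : measurableType d2) (R : realType)
    (P : probability T R) (D : probability T2 R) (X : T -> T1) (Y : T -> T2)
    (phi : T1 * T2 -> \bar R) :
  measurable_fun setT X -> measurable_fun setT Y ->
  (forall U V, measurable U -> measurable V ->
     P (X @^-1` U `&` Y @^-1` V) = P (X @^-1` U) * D V)%E ->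
  measurable_fun setT phi -> (forall z, 0 <= phi z)%E ->
  (\int[P]_w phi (X w, Y w) = \int[P]_w \int[D]_y phi (X w, y))%E.
Proof.
move=> mX mY XY mphi phi0.
pose XM : {mfun T >-> T1} := HB.pack X (isMeasurableFun.Build _ _ _ _ X mX).
have mXY : measurable_fun setT (fun w => (X w, Y w)).
  exact/measurable_fun_pair.
pose XYM : {mfun T >-> (T1 * T2)%type} :=
  HB.pack (fun w => (X w, Y w)) (isMeasurableFun.Build _ _ _ _ _ mXY).
transitivity (\int[distribution P XYM]_z phi z)%E.
  by rewrite ge0_integral_pushforward.
transitivity (\int[distribution P XM \x D]_z phi z)%E.
  apply: eq_measure_integral => U mU _; apply/esym.
  exact: product_measure_unique.
rewrite fubini_tonelli1// ge0_integral_pushforward//.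
- exact: measurable_fun_fubini_tonelli_F.
- by move=> x _; apply: integral_ge0.
Qed.

(** The event [setT] in the definition of conditional expectation gives [V] and [Y] the same
    integral. *)
Lemma condexp_le_integral (d : measure_display) (T : measurableType d)
    (R : realType) (P : probability T R) (G : set (set T))
    (Y V g : T -> \bar R) :
  G setT -> G `<=` measurable -> is_condexp P G Y V ->
  measurable_fun setT g -> (forall w, 0 <= g w)%E ->
  {ae P, forall w, (V w <= g w)%E} ->
  (\int[P]_w Y w <= \int[P]_w g w)%E.
Proof.
move=> GT Gm [mV VY] mg g0 Vg.
have mV' : measurable_fun setT V.
  by move=> _ U mU; rewrite setTI; exact/Gm/mV.
rewrite -VY// integralE.
(* A version [V] may take negative values, so the comparison goes through its positive part. *)
apply: (@le_trans _ _ (\int[P]_w V^\+ w)%E).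
  by rewrite geeDl// oppe_le0 integral_ge0.
apply: ae_ge0_le_integral => //; first exact: measurable_funepos.
by apply: filterS Vg => w Vg _; rewrite funeposE ge_max Vg g0.
Qed.

Lemma g_sigma_algebra_preimage_measurable (d d' : measure_display)
    (T : measurableType d) (T' : measurableType d') (f : T -> T') :
  measurable_fun setT f -> g_sigma_algebra_preimage f `<=` measurable.
Proof. by move=> mf _ [U mU <-]; exact: mf. Qed.

(** * The mean matrix [meanZ] and what exactness says about its kernel *)

Section mean_sketch.
Context (R : realType) (m n : nat) (A : 'M[R]_(m, n)) (b : 'cV[R]_m).
Context (B : 'M[R]_n) (D : probability (rowsmx R m) R).
Hypotheses (Bpos : posdefmx B) (exist : expectations_exist A b B D).

Let iZ i j : D.-integrable setT (fun S => (sketchZ A B S i j)%:E).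
Proof. exact: (proj1 exist). Qed.

(** Extracted from the integrability assumption, which avoids any study of the pseudoinverse as a
    function of [S]. *)
Lemma measurable_sketchZ i j : measurable_fun setT (fun S => sketchZ A B S i j).
Proof. by apply/measurable_EFinP; exact: (measurable_int D (iZ i j)). Qed.

Lemma integral_quad_sketchZ v :
  (\int[D]_S (quad (sketchZ A B S) v)%:E = (quad (meanZ A B D) v)%:E)%E.
Proof. exact: integral_quad. Qed.

Lemma meanZ_sym : (meanZ A B D)^T = meanZ A B D.
Proof.
apply/matrixP => i j; rewrite !mxE; congr (fine 'E_D[_]).
by apply/funext => S; rewrite -[in LHS](sketchZ_sym A Bpos) mxE.
Qed.

Let mquad v : measurable_fun setT (fun S => (quad (sketchZ A B S) v)%:E).
Proof.
apply/measurable_EFinP/measurable_quad => // i j; exact: measurable_sketchZ.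
Qed.

Lemma quad_meanZ_ge0 v : 0 <= quad (meanZ A B D) v.
Proof.
rewrite -lee_fin -integral_quad_sketchZ integral_ge0// => S _.
by rewrite lee_fin quad_sketchZ_ge0.
Qed.

Lemma quad_meanZ_le v : quad (meanZ A B D) v <= quad B v.
Proof.
rewrite -lee_fin -integral_quad_sketchZ.
have -> : ((quad B v)%:E = \int[D]_S (quad B v)%:E)%E.
  rewrite integral_cst// -[LHS]mule1; congr (_ * _)%E.
  exact: esym (probability_setT _).
apply: ge0_le_integral => //.
- by move=> S _; rewrite lee_fin quad_sketchZ_ge0.
- by move=> S _; rewrite lee_fin quad_sketchZ_le.
Qed.

Lemma stochfE xstar x : A *m xstar = b ->
  stochf A b B D x = 2^-1 * quad (meanZ A B D) (x - xstar).
Proof.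
move=> Axstar; rewrite /stochf unlock.
under eq_integral do rewrite (sketchfE _ Axstar) EFinM.
rewrite ge0_integralZl_EFin//; last first.
  by move=> S _; rewrite lee_fin quad_sketchZ_ge0.
by rewrite integral_quad_sketchZ.
Qed.

(** Adding [u] to [xstar] leaves [stochf] at its minimum zero, so exactness makes [xstar + u] a
    solution. *)
Lemma exactness_ker xstar : A *m xstar = b ->
  argmin_on setT (stochf A b B D) = solset A b ->
  forall u : 'cV[R]_n, meanZ A B D *m u = 0 -> A *m u = 0.
Proof.
move=> Axstar exact_min u Zu.
have : solset A b (xstar + u).
  rewrite -exact_min; split => // y _; rewrite !(stochfE _ Axstar).
  rewrite addrAC subrr add0r {1}/quad -mulmxA Zu mulmx0 mxE mulr0.
  by rewrite mulr_ge0// quad_meanZ_ge0.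
by rewrite /solset /= mulmxDr Axstar => /(canRL (addKr b)); rewrite addNr.
Qed.

End mean_sketch.

(** * Measurability, independence and range along a run *)

Section iBasic_run.
Context (R : realType) (m n : nat) (A : 'M[R]_(m, n)) (b : 'cV[R]_m).
Context (B : 'M[R]_n) (D : probability (rowsmx R m) R).
Hypotheses (Bpos : posdefmx B) (exist : expectations_exist A b B D).
Context (d : measure_display) (T : measurableType d) (P : probability T R).
Context (x0 : 'cV[R]_n) (S : nat -> T -> rowsmx R m).
Context (lam : forall (k : nat) (w : T), 'cV[R]_(ncols (S k w))).
Context (x : nat -> T -> 'cV[R]_n) (xstar : 'cV[R]_n).
Hypothesis run : iBasic A B D P 1 x0 lam x.

Let mS k : measurable_fun setT (S k).
Proof. exact: iBasic_measurable_S run k. Qed.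

Let mxk k : measurable_fun setT (x k).
Proof. exact: iBasic_measurable_x run k. Qed.

Lemma current_measurable k : current S x k `<=` measurable.
Proof.
apply: smallest_sub; first exact: sigma_algebra_measurable.
by move=> U [|]; apply: g_sigma_algebra_preimage_measurable.
Qed.

Lemma iBasic_indep k (U : set 'cV[R]_n) (V : set (rowsmx R m)) :
  measurable U -> measurable V ->
  (P (x k @^-1` U `&` S k @^-1` V) = P (x k @^-1` U) * D V)%E.
Proof.
move=> mU mV; rewrite setIC -(iBasic_law run k mV) muleC.
apply: (iBasic_fresh run).
  by exists V => //; rewrite setTI.
(* [past k] is generated with [j <= k], so it contains the events of [x k] itself. *)
apply: sub_sigma_algebra; left; exists k => //=.
by exists U => //; rewrite setTI.
Qed.

Lemma measurable_error k i : measurable_fun setT (fun w => (x k w - xstar) i 0).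
Proof.
have -> : (fun w => (x k w - xstar) i 0) = (fun w => x k w i 0 - xstar i 0).
  by apply/funext => w; rewrite !mxE.
apply: measurable_funB => //.
exact: (measurableT_comp (@measurable_mxentry R n 1 i 0) (mxk k)).
Qed.

Lemma measurable_quadZ k :
  measurable_fun setT (fun w => quad (sketchZ A B (S k w)) (x k w - xstar)).
Proof.
apply: measurable_quad => [i j|i]; last exact: measurable_error.
exact: (measurableT_comp (measurable_sketchZ exist i j) (mS k)).
Qed.

Lemma measurable_quadB k : measurable_fun setT (fun w => quad B (x k w - xstar)).
Proof. by apply: measurable_quad => // i; exact: measurable_error. Qed.

(** The fresh sample is integrated out first, with the iterate frozen. *)
Lemma integral_quadZ k :
  (\int[P]_w (quad (sketchZ A B (S k w)) (x k w - xstar))%:E =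
   \int[P]_w (quad (meanZ A B D) (x k w - xstar))%:E)%E.
Proof.
pose phi (z : 'cV[R]_n * rowsmx R m) :=
  (quad (sketchZ A B z.2) (z.1 - xstar))%:E.
rewrite (@integral_indep _ _ _ _ _ _ _ _ D (x k) (S k) phi)//.
- by apply: eq_integral => w _; rewrite -(integral_quad_sketchZ exist).
- exact: iBasic_indep.
- apply/measurable_EFinP/measurable_quad => [i j|i].
    exact: (measurableT_comp (measurable_sketchZ exist i j)).
  have -> : (fun z : 'cV[R]_n * rowsmx R m => (z.1 - xstar) i 0) =
      (fun z => z.1 i 0 - xstar i 0) by apply/funext => z; rewrite !mxE.
  apply: measurable_funB => //.
  exact: (measurableT_comp (@measurable_mxentry R n 1 i 0)).
- by move=> z; rewrite lee_fin quad_sketchZ_ge0.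
Qed.

Lemma iBasic_range k w : (exists y, x0 - xstar = invmx B *m A^T *m y) ->
  exists y, x k w - xstar = invmx B *m A^T *m y.
Proof.
move=> x0r; elim: k => [|k [y ky]]; first by rewrite (iBasic_init run).
exists (y + mxof (S k w) *m lam k w); rewrite (iBasic_step run) scale1r.
by rewrite addrAC ky mulmxDr !mulmxA.
Qed.

End iBasic_run.

(** * Contraction of the mean squared error over one outer iteration, then induction *)

(** [I] and [I'] stand for the current and next mean squared errors, [Z] for the mean exact
    decrease, [E] for the mean inner error. The real bound [K] forces all four to be finite, after
    which [I' = I - Z + E <= I - (1 - t) Z <= (1 - (1 - t) l) I]. *)
Lemma ereal_contraction (R : realType) (I I' Z E : \bar R) (t l K : R) :
  (0 <= I)%E -> (0 <= I')%E -> (0 <= Z)%E -> (0 <= E)%E ->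
  (I' + Z = I + E)%E -> (E <= t%:E * Z)%E -> (Z <= I)%E -> (l%:E * I <= Z)%E ->
  (I <= K%:E)%E -> t <= 1 -> 0 <= 1 - (1 - t) * l ->
  (I' <= ((1 - (1 - t) * l) * K)%:E)%E.
Proof.
move=> I0 I'0 Z0 E0 + + ZI + IK t1 c0.
case: I => [I| |] // in I0 ZI IK *.
case: Z => [Z| |] // in Z0 ZI *.
case: E => [E| |] // in E0 *.
case: I' => [I'| |] // in I'0 *.
rewrite -!EFinD -!EFinM !lee_fin in I0 I'0 Z0 E0 ZI IK * => -[step] Et lI.
rewrite (@le_trans _ _ ((1 - (1 - t) * l) * I))//; last exact: ler_wpM2l.
have : (1 - t) * (l * I) <= (1 - t) * Z by rewrite ler_wpM2l// subr_ge0.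
lra.
Qed.

Theorem theorem7 (R : realType) (m n : nat)
  (A : 'M[R]_(m, n)) (b : 'cV[R]_m) (B Bhalf : 'M[R]_n)
  (consistent : exists z : 'cV[R]_n, A *m z = b)
  (B_posdef : posdefmx B)
  (Bhalf_sqrt : is_posdef_sqrt B Bhalf)
  (D : probability (rowsmx R m) R)
  (exist : expectations_exist A b B D)
  (lambda_min : R)
  (lambda_minP : is_min_nonzero_eigenvalue (meanW A B D Bhalf) lambda_min)
  (exactness : argmin_on setT (stochf A b B D) = solset A b)
  (d : measure_display) (T : measurableType d) (P : probability T R)
  (r : nat) (x0 : 'cV[R]_n)
  (S : nat -> T -> rowsmx R m)
  (lam : forall (k i : nat) (w : T), 'cV[R]_(ncols (S k w)))
  (x : nat -> T -> 'cV[R]_n)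
  (run : iBasic A B D P 1 x0 (fun k w => lam k r w) x)
  (lam_init : forall k w, lam k 0%N w = 0)
  (rho : rowsmx R m -> R)
  (rho01 : forall k w, 0 < rho (S k w) < 1)
  (inexactness : forall k : nat,
     let err i w : R :=
       mnorm (sketchM A B (S k w))
         (lam k i w - sketch_lambda A b B (S k w) (x k w)) ^+ 2 in
     exists V : T -> \bar R,
       is_condexp P (current S x k) (fun w => (err r w)%:E) V /\
       {ae P, forall w, (V w <= (rho (S k w) ^+ r * err 0%N w)%:E)%E})
  (xstar : 'cV[R]_n)
  (xstarP : argmin_on (solset A b) (fun z => mnorm B (z - x0)) xstar)
  (theta : R) (theta_lt1 : theta < 1)
  (rho_le : forall k, {ae P, forall w, rho (S k w) <= theta}) :
  forall k : nat,
    ('E_P[(fun w => mnorm B (x k w - xstar) ^+ 2)%R] <=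
     ((1 - (1 - theta ^+ r) * lambda_min) ^+ k *
      mnorm B (x0 - xstar) ^+ 2)%:E)%E.
Proof.
have [Axstar _] := xstarP.
have Zsym := meanZ_sym A D B_posdef.
have e0_range := argmin_mnorm_range B_posdef xstarP.
have lmin_le k w : lambda_min * quad B (x k w - xstar) <=
    quad (meanZ A B D) (x k w - xstar).
  apply: (rayleigh_range B_posdef Bhalf_sqrt Zsym lambda_minP).
    exact: (exactness_ker B_posdef exist Axstar exactness).
  exact: iBasic_range run _ _ e0_range.
(* As forms, [0 <= meanZ <= B]; testing this at the vector of [min_eigenvalue_quad] gives both
   bounds, which make the factor [c] nonnegative. *)
have [lmin_ge0 lmin1] : 0 <= lambda_min /\ lambda_min <= 1.
  have [e e0 eZ] := min_eigenvalue_quad Bhalf_sqrt lambda_minP.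
  have eB : 0 < quad B e by exact: (proj2 B_posdef).
  have := quad_meanZ_ge0 B_posdef exist e.
  have := quad_meanZ_le B_posdef exist e.
  by rewrite eZ pmulr_lge0// ger_pMl.
(* An event of probability one is nonempty, so some outcome has [0 < rho <= theta]. *)
have theta_ge0 : 0 <= theta.
  have Pfilter : ProperFilter (almost_everywhere P).
    by apply: ae_properfilter_algebraOfSetsType; rewrite /= probability_setT.
  have [w] := filter_ex (rho_le 0%N); apply: le_trans.
  by apply: ltW; case/andP: (rho01 0%N w).
have t01 : 0 <= theta ^+ r <= 1 by rewrite exprn_ge0//= exprn_ile1// ltW.
set t := theta ^+ r in t01 *; set c := 1 - _.
have c_ge0 : 0 <= c by rewrite /c; nra.
elim=> [|k IHk].
  rewrite unlock (eq_integral (cst (mnorm B (x0 - xstar) ^+ 2)%:E)).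
    rewrite integral_cst// expr0 mul1r [X in (_ * X)%E](_ : _ = 1%E) ?mule1//.
    exact: probability_setT.
  by move=> w _; rewrite (iBasic_init run).
pose z w := quad (sketchZ A B (S k w)) (x k w - xstar).
pose err w := mnorm (sketchM A B (S k w))
  (lam k r w - sketch_lambda A b B (S k w) (x k w)) ^+ 2.
have step w : quad B (x k.+1 w - xstar) + z w = quad B (x k w - xstar) + err w.
  by rewrite (iBasic_step run) scale1r; exact: iBasic_step_quad.
have mB j := measurable_quadB xstar run j.
have mz := measurable_quadZ exist xstar run k.
(* Read off from the step identity, as [mpinv] is not known to be measurable. *)
have merr : measurable_fun setT err.
  have -> : err = fun w =>
      quad B (x k.+1 w - xstar) + z w - quad B (x k w - xstar).
    by apply/funext => w; rewrite step addrAC subrr add0r.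
  exact/measurable_funB/mB/measurable_funD/mz/mB.
move: merr mz => /measurable_EFinP merr /measurable_EFinP mz.
have {}mB j : measurable_fun setT (fun w => (quad B (x j w - xstar))%:E).
  exact/measurable_EFinP.
have z_ge0 w : setT w -> (0 <= (z w)%:E)%E by rewrite lee_fin quad_sketchZ_ge0.
have err_ge0 w : setT w -> (0 <= (err w)%:E)%E by rewrite lee_fin sqr_ge0.
have B_ge0 j w : setT w -> (0 <= (quad B (x j w - xstar))%:E)%E.
  by rewrite lee_fin posdefmx_quad_ge0.
have [B_ge0k B_ge0k1] := (B_ge0 k, B_ge0 k.+1).
have [t0 t1] := andP t01.
have err_le : (\int[P]_w (err w)%:E <= t%:E * \int[P]_w (z w)%:E)%E.
  have [V [Vcond Vle]] := inexactness k.
  (* [rho] need not be measurable, hence the comparison with the constant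
     [theta ^+ r] before integrating. *)
  rewrite -ge0_integralZl_EFin//; apply: (condexp_le_integral _ _ Vcond).
  - by apply: sub_sigma_algebra; right; exists setT; rewrite ?preimage_setT ?setTI.
  - exact: (current_measurable run).
  - exact: measurable_funeM.
  - by move=> w; rewrite mule_ge0// z_ge0.
  (* The start at zero makes the initial inner error equal to [z w], and [0 < rho <= theta] passes
     to [r]-th powers. *)
  apply: filterS2 Vle (rho_le k) => w Vw rw; apply: (le_trans Vw).
  rewrite -EFinM lee_fin lam_init (mnorm_sketch_lambda B_posdef Axstar) -/(z w).
  apply: ler_wpM2r; first by have := z_ge0 w I; rewrite lee_fin.
  by rewrite lerXn2r ?nnegrE// ltW//; case/andP: (rho01 k w).
(* Kept additive: all terms are nonnegative, so the integrals split before anything is known to be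
   finite. *)
have int_step : (\int[P]_w (quad B (x k.+1 w - xstar))%:E + \int[P]_w (z w)%:E =
    \int[P]_w (quad B (x k w - xstar))%:E + \int[P]_w (err w)%:E)%E.
  rewrite -!ge0_integralD//.
  by apply: eq_integral => w _; rewrite -!EFinD step.
have z_le : (\int[P]_w (z w)%:E <= \int[P]_w (quad B (x k w - xstar))%:E)%E.
  by apply: ge0_le_integral => // w _; rewrite lee_fin quad_sketchZ_le.
(* The sample is averaged into [meanZ] first, since the pointwise bound [lmin_le] concerns that mean
   and not the individual [sketchZ]. *)
have z_ge : (lambda_min%:E * \int[P]_w (quad B (x k w - xstar))%:E <=
    \int[P]_w (z w)%:E)%E.
  have -> := integral_quadZ B_posdef exist xstar run k.
  rewrite -ge0_integralZl_EFin//; apply: ge0_le_integral => //.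
  - by move=> w _; rewrite mule_ge0// B_ge0.
  - exact: measurable_funeM.
  - apply/measurable_EFinP/measurable_quad => // i.
    exact: (measurable_error xstar run).
  - by move=> w _; rewrite -EFinM lee_fin lmin_le.
have BE j : ('E_P[fun w => (mnorm B (x j w - xstar) ^+ 2)%R] =
    \int[P]_w (quad B (x j w - xstar))%:E)%E.
  by rewrite unlock; apply: eq_integral => w _; rewrite (mnorm_sqr B_posdef).
rewrite BE in IHk; rewrite BE exprS -mulrA.
by apply: (ereal_contraction _ _ _ _ int_step err_le) => //; exact: integral_ge0.
Qed.
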